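(* Let $T$ be a tree, let $\lambda: T\to(0,\infty)$ be a weight, let $1\le p<\infty$, and let $\varphi:T\to T$ be an injective self-map such that $C_\varphi$ is bounded on $L^p_\lambda(T)$. If $$\lim_{N\to\infty}\ \sup_{|\varphi(v)|\ge N}\frac{\lambda(v)}{\lambda(\varphi(v))}=0,$$ then $C_\varphi$ is compact on $L^p_\lambda(T)$.
   Context: A tree $T$ is a connected, locally finite graph without cycles on a countably infinite vertex set (identified with $T$), with a fixed vertex $o$ called the root, and with no terminal vertices (a terminal vertex is one having only one neighbour). For a vertex $v$, $|v|$ denotes the length (number of edges) of the unique path joining $o$ and $v$. Functions on $T$ are functions on its vertices. For a weight $\lambda:T\to(0,\infty)$ and $1\le p<\infty$, $L^p_\lambda(T)$ is the Banach space of functions $f:T\to\mathbb{C}$ with $\|f\|_p=\big[\sum_{v\in T}|f(v)|^p\lambda(v)\big]^{1/p}<\infty$. For a self-map $\varphi$ of $T$, the composition operator $C_\varphi$ is $C_\varphi f(v)=f(\varphi(v))$; it is bounded on $L^p_\lambda(T)$ if it maps $L^p_\lambda(T)$ into itself and is a bounded linear operator there. The supremum over $|\varphi(v)|\ge N$ is over all $v\in T$ with $|\varphi(v)|\ge N$. *)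

(* Defs.v *)
From HB Require Import structures.
From mathcomp Require Import all_boot all_order all_algebra.
From mathcomp Require Import all_classical all_reals all_analysis.
From mathcomp Require Import complex.

Set Implicit Arguments.
Unset Strict Implicit.
Unset Printing Implicit Defensive.

Import Order.TTheory GRing.Theory Num.Theory.
Import numFieldNormedType.Exports.

Local Open Scope classical_set_scope.
Local Open Scope ring_scope.
Local Open Scope complex_scope.

(** A cycle is a cyclic sequence of at least three pairwise distinct
    vertices: for a symmetric relation, [ucycle] also accepts the two-vertex
    sequences [:: u; v] with [e u v], hence the bound on the size. *)
Record is_tree (T : choiceType) (e : rel T) : Prop := IsTree {
  tree_countably_infinite : ([set: T] #= [set: nat])%card ;
  tree_sym : symmetric e ;
  tree_irrefl : irreflexive e ;
  tree_locally_finite : forall v, finite_set [set w | e v w] ;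
  tree_connected : forall u v, exists2 q : seq T, path e u q & last u q = v ;
  tree_acyclic : forall c : seq T, (2 < size c)%N -> ~ ucycle e c ;
  tree_no_terminal : forall v w, [set u | e v u] <> [set w]
}.

(** A path is stored without its first vertex, so that the size of the
    sequence is the number of edges.  In a tree the set below is a
    singleton for every [v]. *)
Definition vlength (T : choiceType) (e : rel T) (o v : T) : nat :=
  size (xget [::] [set q : seq T |
                    [/\ path e o q, uniq (o :: q) & last o q = v]]).

Section weighted_Lp.
Context (R : realType) (T : choiceType).
Implicit Types (lam : T -> R) (p : R) (f g : T -> R[i]).

Import ComplexField.Normc.

Definition Lp_sum lam p f : \bar R :=
  \esum_(v in [set: T]) ((normc (f v) `^ p) * lam v)%:E.

Definition Lp_enorm lam p f : \bar R := (Lp_sum lam p f `^ p^-1)%E.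

Lemma normc_ge0 (z : R[i]) : 0 <= normc z.
Proof. by case: z => a b /=; exact: sqrtr_ge0. Qed.

Lemma normcD (z w : R[i]) : normc (z + w) <= normc z + normc w.
Proof.
have := ler_normD z w; rewrite !normc_def -rmorphD lecR.
by case: z w => [a b] [c d].
Qed.

Lemma esumZl (c : R) (a : T -> R) : 0 <= c -> (forall v, 0 <= a v) ->
  \esum_(v in [set: T]) (c * a v)%:E
  = (c%:E * \esum_(v in [set: T]) (a v)%:E)%E.
Proof.
have main (c' : R) (a' : T -> R) : 0 <= c' -> (forall v, 0 <= a' v) ->
  (\esum_(v in [set: T]) (c' * a' v)%:E
  <= (c'%:E * \esum_(v in [set: T]) (a' v)%:E))%E.
  move=> c0 a0; apply: ge_ereal_sup => _ [X XT <-].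
  under eq_fsbigr do rewrite EFinM.
  rewrite -ge0_mule_fsumr; last by move=> v; rewrite lee_fin.
  by rewrite lee_wpmul2l ?lee_fin//; apply: esum_ge; exists X.
move=> c0 a0; apply/eqP; rewrite eq_le main//=.
have [->|cn0] := eqVneq c 0.
  by rewrite mul0e esum_ge0// => v _; rewrite lee_fin mul0r.
have cp : 0 < c by rewrite lt_def cn0.
have := main c^-1 (fun v => c * a v).
rewrite invr_ge0 => /(_ c0) H.
have {}H := H (fun v => mulr_ge0 c0 (a0 v)).
rewrite [leLHS](_ : _ = \esum_(v in [set: T]) (a v)%:E)%E in H; last first.
  by apply: eq_esum => v _; rewrite mulKf.
by rewrite lee_pdivlMl in H.
Qed.

Context lam p (lam_gt0 : forall v, 0 < lam v) (p_ge1 : 1 <= p).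

Let p_gt0 : 0 < p. Proof. exact: lt_le_trans p_ge1. Qed.
Let p_neq0 : p != 0. Proof. by rewrite gt_eqF. Qed.
Let term_ge0 f v : 0 <= (normc (f v) `^ p) * lam v.
Proof. by rewrite mulr_ge0 ?powR_ge0 ?ltW. Qed.

Lemma Lp_sum_ge0 f : (0 <= Lp_sum lam p f)%E.
Proof. by apply: esum_ge0 => v _; rewrite lee_fin. Qed.

Lemma Lp_enorm_ge0 f : (0 <= Lp_enorm lam p f)%E.
Proof. exact: poweR_ge0. Qed.

Lemma Lp_sumE f : Lp_sum lam p f = (Lp_enorm lam p f `^ p)%E.
Proof. by rewrite -poweRrM mulVf// poweRe1// Lp_sum_ge0. Qed.

Lemma Lp_enorm0 : Lp_enorm lam p 0 = 0%E.
Proof.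
rewrite /Lp_enorm /Lp_sum esum1 ?poweR0r ?invr_neq0// => v _.
by rewrite normc0 powR0// mul0r.
Qed.

Lemma Lp_enormZ (c : R[i]) f :
  Lp_enorm lam p (c *: f) = ((normc c)%:E * Lp_enorm lam p f)%E.
Proof.
rewrite /Lp_enorm {1}/Lp_sum.
under eq_esum.
  move=> v _; rewrite (_ : (c *: f) v = c * f v)// normcM powRM ?normc_ge0//.
  rewrite -mulrA; over.
rewrite esumZl ?powR_ge0// poweRM ?lee_fin ?powR_ge0//; last exact: Lp_sum_ge0.
by rewrite poweR_EFin -powRrM mulfV// powRr1 ?normc_ge0.
Qed.

Lemma Lp_enorm_le f (a : R) : 0 <= a ->
  (Lp_enorm lam p f <= a%:E)%E = (Lp_sum lam p f <= (a `^ p)%:E)%E.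
Proof.
move=> a0; apply/idP/idP => H.
  rewrite Lp_sumE -poweR_EFin gt0_ler_poweR// ?ltW// in_itv/= ?Lp_enorm_ge0 ?leey//.
  by rewrite lee_fin a0.
rewrite /Lp_enorm (_ : a%:E = ((a `^ p)%:E `^ p^-1)%E); last first.
  by rewrite poweR_EFin -powRrM mulfV// powRr1.
rewrite gt0_ler_poweR// ?invr_ge0 ?ltW// in_itv/= ?Lp_sum_ge0 ?leey//.
by rewrite lee_fin powR_ge0.
Qed.

Lemma powR_normcD (z w : R[i]) (a b : R) : 0 < a -> 0 < b ->
  normc (z + w) `^ p <=
  (a + b) `^ p * (a / (a + b)) / (a `^ p) * (normc z `^ p)
  + (a + b) `^ p * (b / (a + b)) / (b `^ p) * (normc w `^ p).
Proof.
move=> a0 b0; have ab0 : 0 < a + b by exact: addr_gt0.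
set x := normc z; set y := normc w.
have x0 : 0 <= x by exact: normc_ge0.
have y0 : 0 <= y by exact: normc_ge0.
have t0 : 0 <= a / (a + b) by rewrite divr_ge0// ltW.
have t1 : a / (a + b) <= 1 by rewrite ler_pdivrMr// mul1r lerDl ltW.
have tc : 1 - a / (a + b) = b / (a + b).
  by apply/eqP; rewrite subr_eq -mulrDl addrC divff// gt_eqF.
have H : (a / (a + b) * (x / a) + (1 - a / (a + b)) * (y / b)) `^ p <=
    a / (a + b) * (x / a) `^ p + (1 - a / (a + b)) * (y / b) `^ p.
  by apply: (convex_powR p_ge1 (Itv01 t0 t1));
    rewrite !inE/= in_itv/= andbT divr_ge0// ltW.
rewrite {}tc in H.
apply: (@le_trans _ _ ((x + y) `^ p)).
  by rewrite ge0_ler_powR ?nnegrE ?normc_ge0 ?addr_ge0 ?(ltW p_gt0)// normcD.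
have xE (c u : R) : 0 < c -> (a + b) * (c / (a + b) * (u / c)) = u.
  by move=> c0; rewrite mulrA (mulrC (a + b)) divfK ?gt_eqF// mulrC divfK// gt_eqF.
have pE (c u : R) : 0 < c -> 0 <= u -> (u / c) `^ p = u `^ p / c `^ p.
  by move=> c0 u0; rewrite powRM ?invr_ge0 ?(ltW c0)// -powR_inv1 ?(ltW c0)//
    powRAC powR_inv1// powR_ge0.
rewrite -{1}(xE a x a0) -{1}(xE b y b0) -mulrDr.
rewrite powRM ?(ltW ab0)//; last first.
  by rewrite addr_ge0// mulr_ge0// divr_ge0// ltW.
apply: (le_trans (ler_wpM2l (powR_ge0 _ _) H)).
by rewrite !pE// mulrDr !mulrA ![_ * (_ `^ p) / _]mulrAC.
Qed.

Lemma Lp_enormD f g :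
  (Lp_enorm lam p (f + g)%R <= Lp_enorm lam p f + Lp_enorm lam p g)%E.
Proof.
have H (a b : R) : 0 < a -> 0 < b -> (Lp_enorm lam p f <= a%:E)%E ->
    (Lp_enorm lam p g <= b%:E)%E -> (Lp_enorm lam p (f + g)%R <= (a + b)%:E)%E.
  move=> a0 b0; have ab0 : 0 < a + b by exact: addr_gt0.
  have [/ltW a0' /ltW b0' /ltW ab0'] := And3 a0 b0 ab0.
  rewrite !Lp_enorm_le// => fa gb.
  set k := (a + b) `^ p * (a / (a + b)) / (a `^ p).
  set l := (a + b) `^ p * (b / (a + b)) / (b `^ p).
  have k0 : 0 <= k by rewrite !(divr_ge0, mulr_ge0, powR_ge0).
  have l0 : 0 <= l by rewrite !(divr_ge0, mulr_ge0, powR_ge0).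
  apply: (@le_trans _ _ (k%:E * Lp_sum lam p f + l%:E * Lp_sum lam p g)%E).
    rewrite /Lp_sum -!esumZl// -esumD; last 2 first.
      by move=> v _; rewrite lee_fin mulr_ge0.
      by move=> v _; rewrite lee_fin mulr_ge0.
    apply: le_esum => v _; rewrite -EFinD lee_fin !mulrA -mulrDl.
    by apply: ler_wpM2r; [exact: ltW|exact: powR_normcD].
  apply: (@le_trans _ _ (k%:E * (a `^ p)%:E + l%:E * (b `^ p)%:E)%E).
    by rewrite leeD// lee_wpmul2l.
  rewrite -!EFinM -EFinD lee_fin /k /l !divfK ?gt_eqF ?powR_gt0//.
  by rewrite -mulrDr -mulrDl divff ?mulr1 ?gt_eqF.
have [->|fy] := eqVneq (Lp_enorm lam p f) +oo%E.
  by rewrite addye ?leey// -ltNye (lt_le_trans _ (Lp_enorm_ge0 _)).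
have [->|gy] := eqVneq (Lp_enorm lam p g) +oo%E.
  by rewrite addey ?leey// -ltNye (lt_le_trans _ (Lp_enorm_ge0 _)).
have ff : Lp_enorm lam p f \is a fin_num by rewrite ge0_fin_numE ?Lp_enorm_ge0 ?ltey.
have gf : Lp_enorm lam p g \is a fin_num by rewrite ge0_fin_numE ?Lp_enorm_ge0 ?ltey.
apply/lee_addgt0Pr => e e0.
have e20 : 0 < e / 2 by rewrite divr_gt0.
rewrite -(fineK ff) -(fineK gf) -!EFinD.
have -> : fine (Lp_enorm lam p f) + fine (Lp_enorm lam p g) + e
  = (fine (Lp_enorm lam p f) + e / 2) + (fine (Lp_enorm lam p g) + e / 2).
  by rewrite addrACA -splitr.
apply: H.
- by rewrite ltr_wpDl// fine_ge0// Lp_enorm_ge0.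
- by rewrite ltr_wpDl// fine_ge0// Lp_enorm_ge0.
- by rewrite -{1}(fineK ff) lee_fin lerDl ltW.
- by rewrite -{1}(fineK gf) lee_fin lerDl ltW.
Qed.

Lemma Lp_enorm_eq0 f : Lp_enorm lam p f = 0%E -> f = 0.
Proof.
move=> f0; apply/funext => v.
have : (Lp_sum lam p f <= 0)%E.
  by rewrite Lp_sumE f0 poweR0r.
move=> s0; have : (((normc (f v) `^ p) * lam v)%:E <= 0)%E.
  apply: le_trans s0; apply: esum_ge; exists [set v]; last by rewrite fsbig_set1.
  by split => //; exact: finite_set1.
rewrite lee_fin pmulr_lle0// => h.
have /eqP : normc (f v) `^ p = 0 by apply/eqP; rewrite eq_le h powR_ge0.
by rewrite powR_eq0 => /andP[/eqP/eq0_normc].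
Qed.

End weighted_Lp.

(** Depending on the two hypotheses makes the vector space and norm
    structures canonical. *)
Definition Lp_pred (R : realType) (T : choiceType) (lam : T -> R) (p : R)
    (lam_gt0 : forall v, 0 < lam v) (p_ge1 : 1 <= p) : {pred T -> R[i]} :=
  fun f => (Lp_enorm lam p f < +oo)%E.

Record Lp (R : realType) (T : choiceType) (lam : T -> R) (p : R)
    (lam_gt0 : forall v, 0 < lam v) (p_ge1 : 1 <= p) : Type := MkLp {
  Lp_fun :> T -> R[i] ;
  Lp_funP : Lp_fun \in Lp_pred lam_gt0 p_ge1
}.

Section Lp_structure.
Context (R : realType) (T : choiceType) (lam : T -> R) (p : R)
  (lam_gt0 : forall v, 0 < lam v) (p_ge1 : 1 <= p).

Local Notation Lp := (Lp lam_gt0 p_ge1).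
Local Notation Lp_pred := (Lp_pred lam_gt0 p_ge1).

HB.instance Definition _ := [isSub for @Lp_fun R T lam p lam_gt0 p_ge1].
HB.instance Definition _ := [Choice of Lp by <:].

Fact Lp_submod_closed : submod_closed Lp_pred.
Proof.
split; first by rewrite unfold_in (Lp_enorm0 _ p_ge1) ltry.
move=> c f g; rewrite !unfold_in => ff gf.
apply: (le_lt_trans (Lp_enormD lam_gt0 p_ge1 _ _)).
by rewrite (Lp_enormZ lam_gt0 p_ge1) lte_add_pinfty// lte_mul_pinfty ?lee_fin ?normc_ge0.
Qed.

HB.instance Definition _ := GRing.isSubmodClosed.Build _ _ Lp_pred
  Lp_submod_closed.
HB.instance Definition _ := [SubChoice_isSubLmodule of Lp by <:].

(** The library norm of a module over [R[i]] is [R[i]]-valued. *)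
Definition Lp_norm (f : Lp) : R[i] := (fine (Lp_enorm lam p f))%:C.

Fact Lp_enorm_fin_num (f : Lp) : Lp_enorm lam p f \is a fin_num.
Proof.
by rewrite ge0_fin_numE ?Lp_enorm_ge0//; have := Lp_funP f; rewrite unfold_in.
Qed.

Fact Lp_normD (f g : Lp) : Lp_norm (f + g) <= Lp_norm f + Lp_norm g.
Proof.
rewrite /Lp_norm -rmorphD lecR -lee_fin EFinD !fineK ?Lp_enorm_fin_num//.
exact: (Lp_enormD lam_gt0 p_ge1).
Qed.

Fact Lp_normZ (c : R[i]) (f : Lp) : Lp_norm (c *: f) = `|c| * Lp_norm f.
Proof.
rewrite /Lp_norm (Lp_enormZ lam_gt0 p_ge1) fineM ?Lp_enorm_fin_num//.
by rewrite rmorphM; case: c.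
Qed.

Fact Lp_norm_eq0 (f : Lp) : Lp_norm f = 0 -> f = 0.
Proof.
move=> /complexI f0; apply/val_inj/(Lp_enorm_eq0 lam_gt0 p_ge1).
by rewrite -(fineK (Lp_enorm_fin_num f)) f0.
Qed.

HB.instance Definition _ := Lmodule_isNormed.Build R[i] Lp
  Lp_normD Lp_normZ Lp_norm_eq0.

Definition comp_maps_Lp (phi : T -> T) : Prop :=
  forall f : Lp, (f : T -> R[i]) \o phi \in Lp_pred.

Definition comp_op (phi : T -> T) (maps : comp_maps_Lp phi) (f : Lp) : Lp :=
  MkLp (maps f).

Fact comp_op_is_linear (phi : T -> T) (maps : comp_maps_Lp phi) :
  linear (comp_op maps).
Proof. by move=> c f g; apply/val_inj. Qed.

HB.instance Definition _ (phi : T -> T) (maps : comp_maps_Lp phi) :=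
  GRing.isLinear.Build R[i] Lp Lp _ (comp_op maps) (comp_op_is_linear maps).

End Lp_structure.

Section operators.
Context (K : numFieldType) (V W : normedModType K).

Definition bounded_operator (A : {linear V -> W}) : Prop :=
  exists M : K, forall x, `|A x| <= M * `|x|.

Definition compact_operator (A : {linear V -> W}) : Prop :=
  precompact (A @` [set x | `|x| <= 1]).

End operators.

(* Main.v *)
Require Import Defs.
From HB Require Import structures.
From mathcomp Require Import all_boot all_order all_algebra.
From mathcomp Require Import all_classical all_reals all_analysis.
From mathcomp Require Import complex finmap.

Set Implicit Arguments.
Unset Strict Implicit.
Unset Printing Implicit Defensive.

Import Order.TTheory GRing.Theory Num.Theory.
Import numFieldNormedType.Exports.

Local Open Scope classical_set_scope.
Local Open Scope ring_scope.

(** An ultrafilter containing the closed unit ball of [Lp] converges pointwise,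
    by boundedness of each coordinate, to some [f] which is again in the ball.
    Along it [C_phi h] converges to [C_phi f] in norm: the vertices [v] with
    [phi v] far from the root contribute at most [d * |f - h|^p] to
    [|C_phi f - C_phi h|^p], since [lam v <= d * lam (phi v)] there and [phi] is
    injective, and the remaining vertices are finitely many because [phi] is
    injective and balls of the tree are finite.  So the image of the unit ball
    is compact, and not only precompact; completeness of [Lp] is not needed. *)

Import ComplexField.Normc.

(** Local finiteness gives, by induction on [k], that walks of [k] edges from [o] have finitely many
    endpoints; the sets [W k] with [k < n] cover the ball. *)
Lemma vlength_ball_finite (T : choiceType) (e : rel T) (o : T) (n : nat) :
  (forall v, finite_set [set w | e v w]) ->
  (forall v, exists2 q, path e o q & last o q = v) ->
  finite_set [set v | (vlength e o v < n)%N].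
Proof.
move=> e_fin e_conn.
pose W k := [set v | exists q, [/\ path e o q, last o q = v & size q = k]].
have W_fin k : finite_set (W k).
  elim: k => [|k IHk].
    apply: (sub_finite_set _ (finite_set1 o)) => v [q [_ <- /size0nil ->]] //.
  apply: (sub_finite_set _ (bigcup_finite IHk (fun v _ => e_fin v))) => v [q []].
  elim/last_ind: q => [//|q x _]; rewrite rcons_path last_rcons size_rcons.
  move=> /andP[eq qx] <- [qk]; exists (last o q) => //.
  by exists q.
apply: (sub_finite_set _ (bigcup_finite (finite_II n) (fun k _ => W_fin k))).
move=> v /= vn; exists (vlength e o v) => //.
have [q pq qv] := e_conn v.
(* The default [[::]] of [xget] never occurs: any walk from [o] to [v] shortens to a duplicate-free
   one. *)
rewrite /vlength; case: xgetP => [q' _ [? _ ?]|nq]; first by exists q'.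
case/shortenP: pq qv => q' pq' uq' _ q'v.
by case: (nq q').
Qed.

Lemma fmap_ultra (T U : Type) (f : T -> U) (F : set_system T) :
  UltraFilter F -> UltraFilter (f @ F).
Proof.
move=> FU; split=> [|G GF FG]; first exact: fmap_proper_filter.
apply/seteqP; split => // A GA.
have [//|FnA] := in_ultra_setVsetC (f @^-1` A) FU.
have /filter_ex[x [Ax nAx]] : G (A `&` ~` A).
  by apply: filterI => //; exact: FG.
by [].
Qed.

(** Ultrafilters on the image are pulled back along a section of [A]. As [X] carries no topology,
    [x] may be found by any means, here as a pointwise limit. *)
Lemma compact_image_ultra (X : Type) (Y : topologicalType) (A : X -> Y)
    (U : set X) :
  (forall F : set_system X, UltraFilter F -> F U ->
    exists2 x, U x & A @ F --> A x) ->
  compact (A @` U).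
Proof.
move=> AU; rewrite compact_ultra => G GU GAU.
have [_ [x0 _ _]] : (A @` U) !=set0 by exact: filter_ex GAU.
have /choice[s sP] : forall y, exists x, (A @` U) y -> U x /\ A x = y.
  move=> y; have [[x Ux Axy]|nAUy] := pselect ((A @` U) y); first by exists x.
  by exists x0.
have sGU := fmap_ultra s GU.
have sU : G (s @^-1` U) by apply: filterS GAU => y /sP[].
have [x Ux Ax] := AU _ sGU sU.
exists (A x); split; first by exists x.
(* [A \o s] is the identity on the image of [U], which belongs to [G]; so pushing [G] through [s]
   and then [A] gives back [G]. *)
apply: cvg_trans Ax => P GP.
have {}GP : G (fun y => P (A (s y))) := GP.
by apply: filterS (filterI GAU GP) => y [/sP[_ ->]].
Qed.

Lemma ultra_bounded_cvg (R : realType) (I : Type) (F : set_system I)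
    (u : I -> R) (B : R) : UltraFilter F ->
  (\forall i \near F, `|u i| <= B) -> exists l : R, u @ F --> l.
Proof.
move=> FU uB; have uFU := fmap_ultra u FU.
have := @segment_compact R (- B) B; rewrite compact_ultra.
move=> /(_ _ uFU)[|l [_ ul]]; last by exists l.
by apply: filterS uB => i; rewrite ler_norml /= in_itv.
Qed.

(** Real and imaginary parts converge separately, by compactness of real segments. The limit is
    stated through the real-valued [normc] because [Lp_sum] is built from it. *)
Lemma ultra_bounded_normc_cvg (R : realType) (I : Type) (F : set_system I)
    (z : I -> R[i]) (B : R) : UltraFilter F ->
  (\forall i \near F, normc (z i) <= B) ->
  exists l : R[i], (fun i => normc (l - z i)) @ F --> (0 : R).
Proof.
move=> FU zB.
have normRe (w : R[i]) : `|complex.Re w| <= normc w.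
  case: w => a b /=; rewrite -sqrtr_sqr ler_wsqrtr// lerDl sqr_ge0//.
have normIm (w : R[i]) : `|complex.Im w| <= normc w.
  case: w => a b /=; rewrite -sqrtr_sqr ler_wsqrtr// lerDr sqr_ge0//.
have [a za] : exists l : R, (fun i => complex.Re (z i)) @ F --> l.
  apply: (ultra_bounded_cvg (B := B)).
  by apply: filterS zB => i /=; apply: le_trans.
have [b zb] : exists l : R, (fun i => complex.Im (z i)) @ F --> l.
  apply: (ultra_bounded_cvg (B := B)).
  by apply: filterS zB => i /=; apply: le_trans.
exists (Complex a b).
have -> : (fun i => normc (Complex a b - z i)) =
    (fun i => Num.sqrt ((a - complex.Re (z i)) ^+ 2 +
                        (b - complex.Im (z i)) ^+ 2)).
  by apply/funext => i; case: (z i).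
have sq0 (x : I -> R) (y : R) : x @ F --> y ->
    (fun i => (y - x i) ^+ 2) @ F --> (0 : R).
  move=> xy; have yx0 : (fun i => y - x i) @ F --> (0 : R).
    by rewrite -(subrr y); apply: cvgB => //; exact: cvg_cst.
  rewrite -(mul0r 0); under eq_fun do rewrite expr2.
  exact: cvgM.
have sum0 := cvgD (sq0 _ _ za) (sq0 _ _ zb); rewrite addr0 in sum0.
by have := cvg_comp _ _ (sum0 _) (@sqrt_continuous R 0); rewrite sqrtr0; exact.
Qed.

Section Lp_lemmas.
Context (R : realType) (T : choiceType) (lam : T -> R) (p : R).
Hypotheses (lam_gt0 : forall v, 0 < lam v) (p_ge1 : 1 <= p).
Local Notation Lp := (Lp lam_gt0 p_ge1).

Let p_gt0 : 0 < p. Proof. exact: lt_le_trans p_ge1. Qed.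
Let pow1p : 1 `^ p = 1 :> R. Proof. by rewrite powR1. Qed.
Let term_ge0 (f : T -> R[i]) v : 0 <= normc (f v) `^ p * lam v.
Proof. by rewrite mulr_ge0 ?powR_ge0 ?ltW. Qed.

Lemma Lp_norm_le (f : Lp) (a : R) : 0 <= a ->
  (`|f| <= (a%:C)%C) = (Lp_sum lam p f <= (a `^ p)%:E)%E.
Proof.
move=> a0; rewrite -Lp_enorm_le//.
by rewrite -(fineK (Lp_enorm_fin_num f)) lee_fin -lecR.
Qed.

Lemma Lp_sum_restrict (X : set T) (f : T -> R[i]) :
  Lp_sum lam p (fun v => if v \in X then f v else 0) =
  (\esum_(v in X) (normc (f v) `^ p * lam v)%:E)%E.
Proof.
rewrite [RHS]esum_mkcond; apply: eq_esum => v _; case: ifP => // _.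
by rewrite normc0 powR0 ?gt_eqF// mul0r.
Qed.

Lemma le_Lp_sum_esum (X : set T) (f : T -> R[i]) :
  (\esum_(v in X) (normc (f v) `^ p * lam v)%:E <= Lp_sum lam p f)%E.
Proof.
rewrite esum_mkcond; apply: le_esum => v _.
by case: ifP => // _; rewrite lee_fin.
Qed.

Lemma near_esum_powR_le (I : Type) (F : set_system I) (u : I -> T -> R[i])
    (X : set T) : Filter F -> finite_set X ->
  (forall v, (fun i => normc (u i v)) @ F --> (0 : R)) ->
  forall eps : R, 0 < eps -> \forall i \near F,
  (\esum_(v in X) (normc (u i v) `^ p * lam v)%:E <= eps%:E)%E.
Proof.
move=> FF finX u0 eps eps0.
have term0 v : (fun i => normc (u i v) `^ p * lam v) @ F --> (0 : R).
  rewrite -(mul0r (lam v)); apply: cvgMl.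
  apply/cvgrPdist_le => d d0.
  (* The threshold is the [p]-th root of [d], so that raising to the power [p] returns [d]. *)
  have := u0 v => /cvgrPdist_le/(_ (d `^ p^-1) (powR_gt0 _ d0)).
  apply: filterS => i; rewrite !sub0r !normrN ger0_norm ?normc_ge0// => ud.
  rewrite ger0_norm ?powR_ge0//.
  have := ge0_ler_powR (ltW p_gt0) (normc_ge0 (u i v)) (powR_ge0 d p^-1) ud.
  by rewrite -powRrM mulVf ?gt_eqF// powRr1// ltW.
have : (fun i => \sum_(v <- fset_set X) normc (u i v) `^ p * lam v) @ F --> (0 : R).
  have := cvg_big (x0 := 0) (P := xpredT) (r := fset_set X) (Fa := fun=> 0)
    (@add_continuous R) FF (fun v _ => term0 v).
  by rewrite big1_eq; exact.
move=> /cvgrPdist_le/(_ eps eps0); apply: filterS => i.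
rewrite sub0r normrN ger0_norm ?sumr_ge0// => le_eps.
by rewrite esum_fset// => [|v _]; rewrite ?lee_fin// fsbig_finite// sumEFin lee_fin.
Qed.

(** A Fatou-type argument: the norm bound passes to the pointwise limit because it can be tested on
    finite sets of vertices. *)
Lemma ultra_unit_ball_cvg (F : set_system Lp) :
  UltraFilter F -> F [set f | `|f| <= 1] ->
  exists2 f : Lp, `|f| <= 1 &
    forall v, (fun h : Lp => normc (f v - h v)) @ F --> (0 : R).
Proof.
move=> FU FB.
have ballE (h : Lp) : (`|h| <= 1) = (Lp_sum lam p h <= 1%:E)%E.
  by rewrite -pow1p -Lp_norm_le.
have /choice[f hf] : forall v, exists l : R[i],
    (fun h : Lp => normc (l - h v)) @ F --> (0 : R).
  (* The single term at [v] of the sum for [h] is at most 1, which bounds [normc (h v)] by the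
     [p]-th root of [1 / lam v]. *)
  move=> v; apply: (ultra_bounded_normc_cvg (B := (lam v)^-1 `^ p^-1)).
  apply: filterS FB => h /=; rewrite ballE => h1.
  have := le_trans (le_Lp_sum_esum [set v] h) h1.
  rewrite esum_set1 ?lee_fin// -ler_pdivlMr// mul1r => hv.
  have ip0 : 0 <= p^-1 by rewrite invr_ge0 ltW.
  have := ge0_ler_powR ip0 (powR_ge0 _ _) (ltW _) hv.
  by rewrite -powRrM mulfV ?gt_eqF// powRr1 ?normc_ge0//; apply; rewrite invr_gt0.
have f1 : (Lp_sum lam p f <= 1%:E)%E.
  apply: ge_ereal_sup => _ [X [finX _] <-].
  rewrite -esum_fset//; last by move=> v _; rewrite lee_fin.
  rewrite -Lp_sum_restrict -pow1p -Lp_enorm_le//.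
  apply/lee_addgt0Pr => eps eps0.
  have := near_esum_powR_le (u := fun (h : Lp) v => f v - h v) _ finX hf
    (powR_gt0 p eps0).
  move=> /(_ _)/(filterI FB)/filter_ex[h []] /=.
  rewrite ballE -Lp_sum_restrict -(Lp_enorm_le _ _ _ (ltW eps0))// => h1 fh.
  (* Minkowski on [X]: the restriction of [h] has norm at most 1 and that of [f - h] at most
     [eps]. *)
  have -> : (fun v => if v \in X then f v else 0) =
      (fun v => if v \in X then h v else 0) +
      (fun v => if v \in X then f v - h v else 0).
    by apply/funext => v /=; rewrite fctE; case: ifP; rewrite ?addr0// addrC subrK.
  apply: (le_trans (Lp_enormD lam_gt0 p_ge1 _ _)); apply: leeD => //.
  rewrite Lp_enorm_le// pow1p Lp_sum_restrict.
  exact: le_trans (le_Lp_sum_esum _ _) h1.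
have fLp : f \in Lp_pred lam_gt0 p_ge1.
  rewrite unfold_in (@le_lt_trans _ _ 1%:E) ?ltry//.
  by rewrite Lp_enorm_le// pow1p.
by exists (MkLp fLp); first rewrite ballE.
Qed.

(** Injectivity turns the sum of the terms at [phi v] into a subsum of [Lp_sum lam p f]; the bound
    on the ratio of weights then costs a factor [d] off [S]. *)
Lemma Lp_sum_comp_le (phi : T -> T) (S : set T) (d : R) (f : T -> R[i]) :
  injective phi -> 0 <= d ->
  (forall v, ~ S v -> lam v / lam (phi v) <= d) ->
  (Lp_sum lam p (f \o phi) <= d%:E * Lp_sum lam p f +
     \esum_(v in S) (normc (f (phi v)) `^ p * lam v)%:E)%E.
Proof.
move=> phi_inj d0 Sd.
have phi_le : (\esum_(v in [set: T]) (normc (f (phi v)) `^ p * lam (phi v))%:E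
    <= Lp_sum lam p f)%E.
  rewrite -(esum_image _ phi (fun v => (normc (f v) `^ p * lam v)%:E)).
    exact: le_Lp_sum_esum.
  by move=> v w _ _; exact: phi_inj.
rewrite /Lp_sum (esumID S); last first.
  by move=> v _; rewrite lee_fin mulr_ge0 ?powR_ge0 ?ltW.
rewrite !setTI addeC leeD2r//.
apply: le_trans (lee_wpmul2l _ phi_le); rewrite ?lee_fin//.
rewrite -esumZl//.
rewrite esum_mkcond; apply: le_esum => v _.
case: ifP => [|_]; last by rewrite lee_fin mulr_ge0.
move=> /set_mem/Sd; rewrite ler_pdivrMr// => vd.
by rewrite lee_fin mulrCA ler_wpM2l ?powR_ge0.
Qed.

End Lp_lemmas.

Theorem theorem4p2 (R : realType) (T : choiceType) (e : rel T) (o : T)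
    (T_tree : is_tree e)
    (lam : T -> R) (lam_gt0 : forall v, 0 < lam v)
    (p : R) (p_ge1 : 1 <= p)
    (phi : T -> T) (phi_inj : injective phi)
    (phi_maps : comp_maps_Lp lam_gt0 p_ge1 phi)
    (phi_bounded : bounded_operator (comp_op phi_maps))
    (lim0 : (fun N : nat =>
       ereal_sup [set (lam v / lam (phi v))%:E
                 | v in [set v | (N <= vlength e o (phi v))%N]])
       @ \oo --> 0%E) :
  compact_operator (comp_op phi_maps).
Proof.
set A := comp_op phi_maps.
have tail (d : R) : 0 < d -> exists2 S : set T, finite_set S &
    forall v, ~ S v -> lam v / lam (phi v) <= d.
  move=> d0.
  have : nbhs 0%E [set x : \bar R | (x < d%:E)%E].
    by apply: open_nbhs_nbhs; split; [exact: open_ereal_lt_ereal|rewrite /= lte_fin].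
  move=> /lim0[N _ /(_ N (leqnn N)) /= supN].
  exists [set v | (vlength e o (phi v) < N)%N].
    apply: (@finite_preimage _ _ [set w | (vlength e o w < N)%N] phi).
      by move=> v w _ _; exact: phi_inj.
    apply: vlength_ball_finite; first exact: tree_locally_finite T_tree.
    exact: tree_connected T_tree o.
  move=> v /negP; rewrite -leqNgt => Nv.
  rewrite -lee_fin (le_trans _ (ltW supN))//.
  by apply: ereal_sup_ubound; exists v.
(* Precompactness asks for a closed compact superset; a compact image in a Hausdorff space is its
   own. *)
suff cptA : compact (A @` [set f | `|f| <= 1]).
  exists (A @` [set f | `|f| <= 1]) => //; split => //.
  by apply: compact_closed => //; exact: norm_hausdorff.
apply: compact_image_ultra => F FU FB.
have [f f1 hf] := ultra_unit_ball_cvg FU FB.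
exists f => //.
apply/cvgrPdist_le => eps eps0.
(* A positive element of [R[i]] has zero imaginary part. *)
have [r r0 ->] : exists2 r : R, 0 < r & eps = (r%:C)%C.
  move: eps0; case: eps => a b; rewrite ltcE /= => /andP[/eqP -> a0].
  by exists a.
(* The budget [r ^ p] is halved: one half for the finite set [S], the other for its complement,
   where [f - h] has norm at most 2 and hence [d * 2 ^ p] must equal [r ^ p / 2]. *)
have c0 : 0 < r `^ p / 2 by rewrite divr_gt0// powR_gt0.
have d0 : 0 < r `^ p / 2 / 2 `^ p by rewrite divr_gt0// powR_gt0.
have [S finS Sd] := tail _ d0.
have := near_esum_powR_le
  (u := fun (h : Lp lam_gt0 p_ge1) v => (f - h) (phi v)) lam_gt0 p_ge1 _ finS
  (fun v => hf (phi v)) c0.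
move=> /(_ _)/(filterI FB); apply: filterS => h [/= h1 hS].
rewrite -(linearB (comp_op phi_maps)) Lp_norm_le ?(ltW r0)//.
apply: (le_trans (Lp_sum_comp_le p lam_gt0
  (f - h : Lp lam_gt0 p_ge1) phi_inj (ltW d0) Sd)).
rewrite [in leRHS](splitr (r `^ p)) EFinD; apply: leeD => //.
have fh : (Lp_sum lam p (f - h : Lp lam_gt0 p_ge1)%R <= (2 `^ p)%:E)%E.
  rewrite -Lp_norm_le// (le_trans (ler_normB _ _))//.
  by rewrite (natrD _ 1 1) rmorphD /= lerD.
apply: (le_trans (lee_wpmul2l _ fh)); first by rewrite lee_fin ltW.
by rewrite -EFinM lee_fin divfK// gt_eqF// powR_gt0.
Qed.
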